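(* Let $G$ be a chordal graph on $n$ vertices with no isolated vertices. Then the noncover complex $NC(G)$ is $(n - i\gamma(G) - 1)$-collapsible.
   Context: Let $G=(V,E)$ be a finite simple graph. A set $I\subset V$ is independent if no two vertices of $I$ are adjacent. A set $W\subset V$ is a (vertex) cover of $G$ if $V\setminus W$ is independent, and a noncover if it is not a cover. The noncover complex $NC(G)$ is the simplicial complex on $V$ whose faces are the noncovers of $G$. For $W\subset V$, let $N(W)$ be the set of vertices adjacent to some vertex of $W$; $W$ dominates $A\subset V$ if $A\subset W\cup N(W)$. The independence domination number $i\gamma(G)$ is the minimum integer $k$ such that for every independent set $I$ of $G$ there is $W\subset V$ with $|W|\le k$ dominating $I$. A graph is chordal if it has no induced cycle of length at least $4$. For a simplicial complex $K$, a face $\sigma$ is free if it is contained in a unique maximal face of $K$; an elementary $d$-collapse removes a free face $\sigma$ with $|\sigma|\le d$ together with all faces containing $\sigma$; $K$ is $d$-collapsible if a finite sequence of elementary $d$-collapses turns $K$ into the void complex. *)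

(* Defs.v *)
From mathcomp Require Import all_boot.

Set Implicit Arguments.
Unset Strict Implicit.
Unset Printing Implicit Defensive.

Section Graphs.

(* A finite simple graph on T is a symmetric irreflexive relation e; these two
   properties are hypotheses of the theorem, the definitions do not need them. *)
Variables (T : finType) (e : rel T).

Definition independent (I : {set T}) : bool :=
  [forall x in I, forall y in I, ~~ e x y].

Definition cover (W : {set T}) : bool := independent (~: W).

Definition noncover_complex : {set {set T}} := [set W | ~~ cover W].

Definition nbhd (W : {set T}) : {set T} := [set v | [exists w in W, e w v]].

Definition dominates (W A : {set T}) : bool := A \subset W :|: nbhd W.

Definition indep_dominable (k : nat) : bool :=
  [forall I : {set T}, independent I ==>
    [exists W : {set T}, (#|W| <= k) && dominates W I]].

Lemma indep_dominable_ex : exists k, indep_dominable k.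
Proof.
exists #|T|; apply/forallP => I; apply/implyP => _; apply/existsP; exists setT.
by rewrite max_card /dominates setTU subsetT.
Qed.

Definition indep_domination_number : nat := ex_minn indep_dominable_ex.

(* All edges between vertices of c join cyclically consecutive vertices. *)
Definition induced_cycle (c : seq T) : bool :=
  ucycleb e c &&
  all2rel (fun x y => e x y ==> (y == next c x) || (y == prev c x)) c.

Definition chordal : Prop := forall c : seq T, 4 <= size c -> ~~ induced_cycle c.

Definition no_isolated : Prop := forall x : T, exists y : T, e x y.

End Graphs.

Section Collapsibility.

(* A complex is given by its set of faces: set0 is the void complex, to be
   distinguished from [set set0], whose only face is the empty one. *)
Variable T : finType.
Implicit Types (K L : {set {set T}}) (s t : {set T}).

Definition simplicial_complex K : Prop :=
  forall s t, t \in K -> s \subset t -> s \in K.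

Definition maximal_face K t : bool := maxset [in K] t.

Definition free_face K s : Prop :=
  s \in K /\ exists! t, maximal_face K t /\ s \subset t.

Definition elementary_collapse (d : nat) K L : Prop :=
  exists s, [/\ free_face K s, #|s| <= d & L = K :\: [set t : {set T} | s \subset t]].

Inductive collapsible (d : nat) : {set {set T}} -> Prop :=
| collapsible_void : collapsible d set0
| collapsible_step K L :
    elementary_collapse d K L -> collapsible d L -> collapsible d K.

Lemma elementary_collapse_complex d K L :
  simplicial_complex K -> elementary_collapse d K L -> simplicial_complex L.
Proof.
move=> cK [r [_ _ ->]] s t; rewrite !inE => /andP[rt tK] st.
rewrite (cK _ _ tK st) andbT.
by apply: contra rt => rs; apply: subset_trans rs st.
Qed.

End Collapsibility.

Lemma noncover_complexP (T : finType) (e : rel T) :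
  simplicial_complex (noncover_complex e).
Proof.
move=> s t; rewrite !inE => nct st; apply: contra nct => /forall_inP cs.
apply/forall_inP => x; rewrite inE => xt; apply/forall_inP => y.
rewrite inE => yt.
have sub z : z \notin t -> z \in ~: s.
  by rewrite inE; apply: contra => /(subsetP st).
by move/forall_inP: (cs x (sub _ xt)); apply; apply: sub.
Qed.

(* Main.v *)
(** Tancer's lemma: if the link of [u] is [d]-collapsible and the deletion of [u]
    is [d.+1]-collapsible, then so is the whole complex. In a chordal graph, the
    last two vertices [v], [u] of a longest induced path satisfy N[v] <= N[u].
    The link of [u] in NC(G) is NC(G - u), and iγ(G - u) >= iγ(G): if [u] is in
    an independent set I, a set dominating I - u + v also dominates I. The
    deletion of [u] consists of the noncovers of G - u where the neighbours of
    [u] have become one-element edges; removing these neighbours one at a time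
    (each deletion being a simplex) leaves NC(G - N[u]), and
    iγ(G) <= iγ(G - N[u]) + 1. Both cases follow by induction on the number of
    vertices. *)

Require Import Defs.
From mathcomp Require Import all_boot zify.

Set Implicit Arguments.
Unset Strict Implicit.
Unset Printing Implicit Defensive.

(** * Links, deletions and collapses *)

Section Collapses.

Variable T : finType.
Implicit Types (K L : {set {set T}}) (s t : {set T}) (u : T).

Definition link K u : {set {set T}} := [set s : {set T} | (u \notin s) && (u |: s \in K)].

Definition deletion K u : {set {set T}} := [set s in K | u \notin s].

Lemma maximal_faceP K t :
  reflect (t \in K /\ forall r, r \in K -> t \subset r -> r = t)
          (maximal_face K t).
Proof.
apply: (iffP maxsetP) => -[tK tmax]; split=> // r rK; exact: tmax.
Qed.

Lemma maximal_face_link K u t :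
  u \notin t -> maximal_face (link K u) t = maximal_face K (u |: t).
Proof.
move=> ut; apply/maximal_faceP/maximal_faceP => -[tK tmax].
  move: (tK); rewrite inE ut => utK; split=> // r rK utr.
  have ur : u \in r by rewrite (subsetP utr) ?setU11.
  rewrite -(setD1K ur) (tmax (r :\ u)) //.
    by rewrite inE !inE eqxx setD1K.
  by rewrite subsetD1 ut (subset_trans (subsetUr _ _) utr).
split=> [|r]; first by rewrite inE ut.
rewrite inE => /andP[ur urK] tr.
by rewrite -(setU1K ur) (tmax (u |: r)) ?setU1K ?setUS.
Qed.

Lemma free_face_link K u s : free_face (link K u) s -> free_face K (u |: s).
Proof.
move=> [sL [t [[tmax st] tuniq]]].
move: sL; rewrite inE => /andP[us usK]; split=> //.
have ut : u \notin t by have /maximal_faceP[] := tmax; rewrite inE => /andP[].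
exists (u |: t); split; first by rewrite -maximal_face_link // setUS.
move=> r [rmax]; rewrite subUset sub1set => /andP[ur sr].
rewrite -(setD1K ur) in rmax *.
rewrite (tuniq (r :\ u)) //; split; last by rewrite subsetD1 sr.
by rewrite maximal_face_link // !inE eqxx.
Qed.

(** A collapse of the link at [s] lifts to a collapse of [K] at [u |: s], one vertex larger, which
    removes only faces containing [u] and so keeps the deletion. When the link has become void, what
    remains is the deletion itself. *)
Lemma collapsible_link_deletion d K u :
  collapsible d (link K u) -> collapsible d.+1 (deletion K u) ->
  collapsible d.+1 K.
Proof.
move EL: (link K u) => L cL; elim: cL K EL => {L} [|L M [s [sfree sd EM]] _ IH] K EL.
  suff -> : deletion K u = K by [].
  apply/setP=> s; rewrite inE; case sK: (s \in K) => //=; apply/negP=> us.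
  have : s :\ u \in link K u by rewrite inE !inE eqxx setD1K.
  by rewrite EL inE.
rewrite -EL in sfree EM.
have us : u \notin s by case: sfree; rewrite inE => /andP[].
move=> cD; apply: (collapsible_step (L := K :\: [set t : {set T} | u |: s \subset t])).
  exists (u |: s); split=> //; first exact: free_face_link.
  by rewrite cardsU1 us.
apply: IH.
  rewrite EM; apply/setP=> t; rewrite !inE.
  case ut: (u \in t); rewrite ?andbF //=; congr (~~ _ && _).
  apply/idP/idP=> [sub|]; last exact: setUS.
  by rewrite -(setU1K us) -(setU1K (negbT ut)) setSD.
suff -> : deletion (K :\: [set t : {set T} | u |: s \subset t]) u = deletion K u by [].
apply/setP=> t; rewrite !inE subUset sub1set.
by case: (u \in t); rewrite ?andbF //=.
Qed.

(** The empty face lies in the single maximal face [A]; collapsing it removes everything. *)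
Lemma collapsible_simplex d (A : {set T}) : collapsible d (powerset A).
Proof.
apply: (@collapsible_step _ _ _ set0); last exact: collapsible_void.
exists set0; split.
- split; first by rewrite powersetE sub0set.
  exists A; split=> [|t [/maximal_faceP[]]].
    split; last exact: sub0set.
    apply/maximal_faceP; rewrite powersetE subxx; split=> // r.
    by rewrite powersetE => rA Ar; apply/eqP; rewrite eqEsubset rA.
  by rewrite powersetE => tA tmax _; apply: tmax; rewrite ?powersetE.
- by rewrite cards0.
- by apply/setP=> s; rewrite !inE sub0set.
Qed.

(* [(m - 1)]-collapsibility, where only the void complex is [(-1)]-collapsible. *)
Definition shifted_collapsible m K : Prop :=
  if m is d.+1 then collapsible d K else K = set0.

Lemma shifted_collapsible_void m : shifted_collapsible m (@set0 {set T}).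
Proof. by case: m => //= d; apply: collapsible_void. Qed.

Lemma shifted_collapsible_link_deletion m K u :
  shifted_collapsible m (link K u) -> shifted_collapsible m.+1 (deletion K u) ->
  shifted_collapsible m.+1 K.
Proof.
case: m => [|d] /=; last exact: collapsible_link_deletion.
move=> L0 cD; suff <- : deletion K u = K by [].
apply/setP=> s; rewrite inE; case sK: (s \in K) => //=; apply/negP=> us.
have : s :\ u \in link K u by rewrite inE !inE eqxx setD1K.
by rewrite L0 inE.
Qed.

End Collapses.

(** * Induced paths and chordality *)

Section InducedPaths.

Variables (T : finType) (e : rel T).
Hypotheses (e_sym : symmetric e) (e_irr : irreflexive e).

Fixpoint induced_path (s : seq T) : bool :=
  if s is x :: s1 then
    [&& x \notin s1, (if s1 is y :: s2 then e x y && ~~ has (e x) s2 else true)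
      & induced_path s1]
  else true.

Lemma induced_path_uniq s : induced_path s -> uniq s.
Proof. by elim: s => //= x s IH /and3P[-> _ /IH]. Qed.

Lemma induced_path_catl s1 s2 : induced_path (s1 ++ s2) -> induced_path s1.
Proof.
elim: s1 => //= x s1 IH; rewrite mem_cat negb_or => /and3P[/andP[-> _] h /IH ->].
by case: s1 h {IH} => //= y s1; rewrite has_cat negb_or andbT => /and3P[-> ->].
Qed.

Lemma induced_path_sorted s : induced_path s -> sorted e s.
Proof. by elim: s => //= x [|y s] IH //= /and3P[_ /andP[-> _] /IH]. Qed.

Lemma induced_path_edge s x y :
  induced_path s -> x \in s -> y \in s -> e x y ->
  exists s1 s2, s = s1 ++ x :: y :: s2 \/ s = s1 ++ y :: x :: s2.
Proof.
elim: s => // z s IH /= /and3P[_ zs ips].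
have first w : w \in s -> e z w -> exists s2, s = w :: s2.
  case: s zs {IH ips} => // a s /andP[_ /hasPn nzs].
  rewrite inE => /predU1P[-> _|ws]; first by exists s.
  by rewrite (negbTE (nzs w ws)).
rewrite !inE => /predU1P[->|xs] /predU1P[->|ys] exy.
- by rewrite e_irr in exy.
- by have [s2 ->] := first y ys exy; exists [::], s2; left.
- by rewrite e_sym in exy; have [s2 ->] := first x xs exy; exists [::], s2; right.
- have [s1 [s2 [->|->]]] := IH ips xs ys exy.
    by exists (z :: s1), s2; left.
  by exists (z :: s1), s2; right.
Qed.

Lemma next_mid (s1 s2 : seq T) x y :
  uniq (s1 ++ x :: y :: s2) -> next (s1 ++ x :: y :: s2) x = y.
Proof.
by move=> us; rewrite -(next_rot (size s1) us) rot_size_cat /= eqxx.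
Qed.

Lemma next_last (s : seq T) x y :
  uniq (x :: rcons s y) -> next (x :: rcons s y) y = x.
Proof.
rewrite -rcons_cons -cats1 => us.
by rewrite -(next_rot (size (x :: s)) us) rot_size_cat /= eqxx.
Qed.

Lemma induced_cycle_closing w x s y :
  induced_path (x :: rcons s y) -> w \notin x :: rcons s y ->
  e w x -> e w y -> ~~ has (e w) s -> induced_cycle e (w :: x :: rcons s y).
Proof.
move=> ip wn ewx ewy /hasPn nws.
set c := w :: _.
have uc : uniq c by rewrite cons_uniq wn induced_path_uniq.
(* Edges at [w] reach only the two ends of the path; all other edges lie in the induced path, hence
   join consecutive vertices. *)
have next_edge a b : a \in c -> b \in c -> e a b -> b = next c a \/ a = next c b.
  have next_w d : d \in x :: rcons s y -> e w d -> d = next c w \/ w = next c d.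
    rewrite !inE mem_rcons inE => /or3P[/eqP-> _|/eqP-> _|/nws/negbTE-> //].
      by left; rewrite /= eqxx.
    by right; rewrite /c -rcons_cons next_last.
  rewrite !(inE, in_cons w) => /predU1P[->|ac] /predU1P[->|bc] eab.
  - by rewrite e_irr in eab.
  - exact: next_w.
  - by rewrite e_sym in eab; have [] := next_w a ac eab; [right | left].
  - have [s1 [s2 [E|E]]] := induced_path_edge ip ac bc eab; rewrite /c E in uc *.
      by left; rewrite -cat_cons next_mid.
    by right; rewrite -cat_cons next_mid.
apply/andP; split.
  apply/andP; split=> //.
  rewrite /c (cycle_path w) /= last_rcons e_sym ewy ewx /=.
  exact: (induced_path_sorted ip).
apply/allrelP=> a b ac bc; apply/implyP=> /(next_edge a b ac bc)[eb|ea].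
  by rewrite -eb eqxx.
by rewrite {2}ea prev_next ?eqxx ?orbT.
Qed.

Hypothesis e_chordal : chordal e.
Implicit Type A : {set T}.

Lemma chordal_dominated_edge A x y :
  x \in A -> y \in A -> e x y ->
  exists u v, [/\ u \in A, v \in A, e u v
    & forall w, w \in A -> e v w -> w != u -> e u w].
Proof.
move=> xA yA exy.
pose good u v := [&& u \in A, v \in A, e u v &
  [forall w in A, e v w ==> (w != u) ==> e u w]].
case: (boolP [exists u, exists v, good u v]).
  move=> /existsP[u /existsP[v /and4P[uA vA euv /forall_inP h]]].
  exists u, v; split=> // w wA evw wu.
  by move: (h w wA); rewrite evw wu.
move=> /existsPn none.
(* If no good pair exists, every induced path in [A] can be prolonged beyond its end [v]. The fuel
   [k] bounds the number of prolongations, as a path has at most [#|T|] vertices. *)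
suff long k v u s : [&& induced_path [:: v, u & s] & all [in A] [:: v, u & s]] ->
    #|T| < k + size [:: v, u & s] -> False.
  case: (long #|T| x y [::]).
    have xy : x != y by apply: contraTneq exy => ->; rewrite e_irr.
    by rewrite /= inE xA yA exy xy.
  by rewrite /=; lia.
elim: k v u s => [|k IH] v u s /andP[ip sA] lt.
  have /card_uniqP E := induced_path_uniq ip.
  by have := max_card (mem [:: v, u & s]); rewrite E; lia.
have /and3P[vA uA _] := sA.
have := ip; rewrite /= => /and3P[_ /andP[evu nvs] _].
have /existsPn/(_ v) := none u.
rewrite /good uA vA e_sym evu /= => /forall_inPn[w wA].
rewrite !negb_imply => /and3P[evw wu neuw].
have wn : w \notin [:: v, u & s].
  rewrite !inE !negb_or wu.
  have -> : w != v by apply: contraTneq evw => ->; rewrite e_irr.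
  by apply: contra nvs => ws; apply/hasP; exists w.
(* If [w] has a neighbour in [s], the path up to the first one, [z], closes with [w] to an induced
   cycle through at least [w], [v], [u], [z]. Otherwise [w] prolongs the path. *)
case: (boolP (has (e w) s)) => [hs|nws].
  have := ip; have := wn.
  case/split_find: hs => z s1 s2 ewz nws1.
  rewrite -!cat_cons => wn1 /induced_path_catl ip1.
  have := @e_chordal (w :: v :: rcons (u :: s1) z).
  rewrite induced_cycle_closing //.
  - by rewrite /= size_rcons => /(_ isT).
  - by move: wn1; rewrite mem_cat negb_or => /andP[].
  - by rewrite e_sym.
  - by rewrite /= negb_or e_sym neuw.
apply: (IH w v (u :: s)); last by move: lt; rewrite /=; lia.
apply/andP; split; last by move: sA; rewrite /= wA.
by apply/and3P; split=> //; rewrite e_sym evw /= negb_or e_sym neuw.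
Qed.

End InducedPaths.

(** * Noncovers with singleton edges *)

Section Noncovers.

Variables (T : finType) (e : rel T).
Hypotheses (e_sym : symmetric e) (e_irr : irreflexive e).
Implicit Types (A I L R W : {set T}).

Lemma independentP A :
  reflect {in A &, forall x y, ~~ e x y} (independent e A).
Proof.
apply: (iffP forall_inP) => h x => [y xA yA|xA].
  by have /forall_inP := h x xA; apply.
by apply/forall_inP=> y; apply: h.
Qed.

Lemma independentS A I : I \subset A -> independent e A -> independent e I.
Proof.
move=> /subsetP IA /independentP h.
by apply/independentP=> x y /IA xA /IA; apply: h.
Qed.

Lemma dominatesP W A :
  reflect {in A, forall x, x \in W \/ exists2 w, w \in W & e w x}
          (dominates e W A).
Proof.
apply: (iffP subsetP) => h x /h.
  by rewrite !inE => /orP[|/exists_inP]; [left | right].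
by rewrite !inE => -[->|/exists_inP->]; rewrite ?orbT.
Qed.

(* Noncovers, on the vertex set [L :|: R], of the hypergraph whose edges are the
   edges of [e] inside [R] and the singletons of [L]. *)
Definition noncovers L R : {set {set T}} :=
  [set s : {set T} | (s \subset L :|: R)
                   && ((L \subset s) ==> ~~ independent e (R :\: s))].

Lemma noncover_complexE : noncover_complex e = noncovers set0 setT.
Proof.
by apply/setP=> s; rewrite !inE set0U subsetT sub0set /cover setTD.
Qed.

Lemma noncovers_independent A : independent e A -> noncovers set0 A = set0.
Proof.
move=> iA; apply/setP=> s; rewrite !inE sub0set /= (independentS _ iA) ?andbF //.
exact: subsetDl.
Qed.

Lemma link_noncovers_edgeset A u :
  u \in A -> link (noncovers set0 A) u = noncovers set0 (A :\ u).
Proof.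
move=> uA; apply/setP=> s.
rewrite !inE !sub0set !set0U subUset sub1set uA subsetD1 /= setDDl.
by case: (u \in s); rewrite ?andbF ?andbT.
Qed.

(** For [s] avoiding [u], the set [A :\: s] contains [u]. It is independent exactly when [s]
    contains all neighbours of [u] in [A] and the nonneighbours outside [s] are independent. *)
Lemma deletion_noncovers A u : u \in A ->
  deletion (noncovers set0 A) u
    = noncovers [set x in A | e u x] [set x in A | (x != u) && ~~ e u x].
Proof.
move=> uA; apply/setP=> s; rewrite !inE !sub0set set0U /=.
have -> : [set x in A | e u x] :|: [set x in A | (x != u) && ~~ e u x] = A :\ u.
  apply/setP=> x; rewrite !inE; case: eqP => [->|_] /=; last first.
    by case: (x \in A); case: (e u x).
  by rewrite e_irr !andbF.
rewrite subsetD1 -!andbA [_ && (u \notin s)]andbC.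
case: (s \subset A) => //=; case us: (u \in s) => //=.
apply/idP/implyP => [nA /subsetP Ns|].
  apply: contra nA => /independentP iR; apply/independentP.
  have noN x : x \in A :\: s -> ~~ e u x.
    rewrite inE => /andP[xs xA]; apply: contra xs => eux.
    by apply: Ns; rewrite inE xA.
  move=> x y xAs yAs.
  case: (eqVneq x u) => [->|xu]; first exact: noN.
  case: (eqVneq y u) => [->|yu]; first by rewrite e_sym noN.
  apply: iR; rewrite !inE ?xu ?yu ?noN //.
    by move: xAs; rewrite inE => /andP[-> ->].
  by move: yAs; rewrite inE => /andP[-> ->].
move=> h; apply/negP=> iA.
case: (boolP ([set x in A | e u x] \subset s)) => [/h/negP|/subsetPn[x]].
  apply; apply: independentS iA.
  by apply/subsetP=> x; rewrite !inE => /and3P[-> ->].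
rewrite inE => /andP[xA eux] xs.
by have /independentP/(_ u x) := iA; rewrite !inE us xs uA xA eux => /(_ isT isT).
Qed.

(** Induction on [L]: the link of [x] in [L] just drops the edge {x}, while a face avoiding [x]
    misses that edge and is a noncover whatever else it contains. *)
Lemma shifted_collapsible_noncovers m L R :
  [disjoint L & R] -> shifted_collapsible m (noncovers set0 R) ->
  shifted_collapsible (#|L| + m) (noncovers L R).
Proof.
move EL: #|L| => l; elim: l L EL => [|l IH] L EL dLR cR.
  by rewrite (cards0_eq EL).
have [x xL] : exists x, x \in L by apply/card_gt0P; rewrite EL.
have xR : x \notin R by rewrite (disjointFr dLR xL).
have RDx s : R :\: (x |: s) = R :\: s.
  apply/setP=> y; rewrite !inE; case: (eqVneq y x) => [->|_] //=.
  by rewrite (negbTE xR) andbF.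
have ELx : #|L :\ x| = l by have := cardsD1 x L; rewrite xL EL => -[].
apply: (shifted_collapsible_link_deletion (u := x)).
  suff -> : link (noncovers L R) x = noncovers (L :\ x) R.
    by apply: IH => //; apply: disjointWl dLR; apply: subsetDl.
  apply/setP=> s; rewrite !inE subUset sub1set inE xL /= RDx subDset.
  rewrite andbA; congr (_ && _).
  have -> : L :\ x :|: R = (L :|: R) :\ x.
    apply/setP=> y; rewrite !inE; case: (eqVneq y x) => [->|_] //=.
    by rewrite (negbTE xR).
  by rewrite subsetD1 andbC.
suff -> : deletion (noncovers L R) x = powerset ((L :|: R) :\ x).
  exact: collapsible_simplex.
apply/setP=> s; rewrite !inE subsetD1.
case xs: (x \in s); rewrite ?andbF ?andbT //.
suff -> : (L \subset s) = false by rewrite andbT.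
by apply/negP=> /subsetP/(_ x xL); rewrite xs.
Qed.

(** * Independence domination in induced subgraphs *)

Definition dominable A k : Prop := forall I, I \subset A -> independent e I ->
  exists W : {set T}, [/\ W \subset A, #|W| <= k & dominates e W I].

Lemma dominable_self A : dominable A #|A|.
Proof.
move=> I IA _; exists I; split=> //; first exact: subset_leq_card.
by rewrite /dominates subsetUl.
Qed.

Lemma dominable_dependent A : ~~ independent e A -> dominable A #|A|.-1.
Proof.
move=> nA I IA iI; exists I; split=> //; last by rewrite /dominates subsetUl.
suff : #|I| < #|A| by lia.
by apply: proper_card; rewrite properEneq IA andbT; apply: contraNneq nA => <-.
Qed.

Lemma dominable_dominated_vertex A u v k :
  u \in A -> v \in A -> e u v ->
  (forall w, w \in A -> e v w -> w != u -> e u w) ->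
  dominable (A :\ u) k -> dominable A k.
Proof.
move=> uA vA euv dom dA I IA iI.
have vu : v != u by apply: contraTneq euv => ->; rewrite e_irr.
suff [J [JA iJ JI]] : exists J : {set T}, [/\ J \subset A :\ u, independent e J
    & forall W, W \subset A :\ u -> dominates e W J -> dominates e W I].
  have [W [WA Wk WJ]] := dA J JA iJ.
  by exists W; split=> //; [apply: subset_trans WA (subsetDl _ _) | apply: JI].
case: (boolP (u \in I)) => uI; last by exists I; rewrite subsetD1 IA.
have nuI x : x \in I -> ~~ e u x by apply: (independentP _ iI).
have nvI x : x \in I -> x != u -> ~~ e v x.
  move=> xI xu; apply: contra (nuI x xI) => evx.
  by apply: dom => //; apply: (subsetP IA).
(* This set is independent: a neighbour of [v] in [I] other than [u] would be adjacent to [u], which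
   is in [I]. *)
exists (v |: I :\ u); split.
- by rewrite subUset sub1set !inE vu vA setSD.
- apply/independentP=> x y; rewrite !inE.
  move=> /predU1P[->|/andP[xu xI]] /predU1P[->|/andP[yu yI]].
  + by rewrite e_irr.
  + exact: nvI.
  + by rewrite e_sym nvI.
  + exact: (independentP _ iI).
- move=> W WA /dominatesP domW; apply/dominatesP=> x xI.
  (* As [W] avoids [u], the vertex dominating [v] is [v] itself or a neighbour of [v] other than
     [u]; either is adjacent to [u]. *)
  case: (eqVneq x u) => [->|xu]; last by apply: domW; rewrite !inE xu xI orbT.
  right; case: (domW v) => [|vW|[w wW ewv]]; first by rewrite setU11.
    by exists v; rewrite // e_sym.
  exists w => //; have := subsetP WA w wW; rewrite !inE => /andP[wu wA].
  by rewrite e_sym dom // e_sym.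
Qed.

(** The extra vertex [u] takes care of itself and its neighbours, so only the part of [I] outside
    its closed neighbourhood is left. *)
Lemma dominable_setU1 A u k : u \in A ->
  dominable [set x in A | (x != u) && ~~ e u x] k -> dominable A k.+1.
Proof.
move=> uA; set R := [set x in A | _] => dR I IA iI.
have [|W [WR Wk /dominatesP domW]] := dR (I :&: R) (subsetIr _ _).
  exact: independentS (subsetIl _ _) iI.
have /subsetP RA : R \subset A by apply/subsetP=> x; rewrite inE => /andP[].
exists (u |: W); split.
- by rewrite subUset sub1set uA; apply/subsetP=> x /(subsetP WR)/RA.
- by rewrite cardsU1; case: (u \notin W) => /=; lia.
- apply/dominatesP=> x xI; rewrite !inE.
  case: (eqVneq x u) => [_|xu] /=; first by left.
  case eux: (e u x); first by right; exists u; rewrite ?setU11.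
  case: (domW x) => [|->|[w wW ewx]]; [|by left|].
    by rewrite !inE xI xu eux (subsetP IA).
  by right; exists w; rewrite // !inE wW orbT.
Qed.

(** * The induction on vertex sets *)

Hypothesis e_chordal : chordal e.

(** The hypothesis expresses |A| - iγ(G[A]) <= m without naming the minimum, so each comparison of
    domination numbers becomes an implication between instances of [dominable]. *)
Lemma shifted_collapsible_chordal A m :
  (forall k, dominable A k -> #|A| <= m + k) ->
  shifted_collapsible m (noncovers set0 A).
Proof.
have [a] := ubnP #|A|; elim: a A m => // a IH A m leAa dA.
case: (boolP (independent e A)) => [iA|nA].
  by rewrite noncovers_independent //; apply: shifted_collapsible_void.
have [x [y [xA yA exy]]] : exists x y, [/\ x \in A, y \in A & e x y].
  move: nA => /forall_inPn[x xA] /forall_inPn[y yA]; rewrite negbK => exy.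
  by exists x, y.
have [u [v [uA vA euv dom]]] :=
  chordal_dominated_edge e_sym e_irr e_chordal xA yA exy.
have cardA : #|A| = (#|A :\ u|).+1 by rewrite (cardsD1 u) uA.
have m_gt0 : 0 < m by have := dA _ (dominable_dependent nA); lia.
case: m m_gt0 dA => // m _ dA.
apply: (shifted_collapsible_link_deletion (u := u)).
  rewrite link_noncovers_edgeset //; apply: IH; first lia.
  move=> k /(dominable_dominated_vertex uA vA euv dom)/dA; lia.
rewrite deletion_noncovers //.
set L := [set x in A | e u x]; set R := [set x in A | _].
have dLR : [disjoint L & R].
  apply/pred0P=> z /=; rewrite !inE.
  by case: (e u z); rewrite ?andbF.
have cardLR : #|A| = (#|L| + #|R|).+1.
  rewrite cardA -cardsUI (disjoint_setI0 dLR) cards0 addn0; congr _.+1.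
  apply: eq_card => z; rewrite !inE.
  case: (eqVneq z u) => [->|_] /=.
    by rewrite e_irr !andbF.
  by case: (z \in A); case: (e u z).
have dR k : dominable R k -> #|L| + #|R| <= m.+1 + k.
  by move=> /(dominable_setU1 uA)/dA; lia.
(* Since [R] dominates itself, [dR] at [#|R|] gives [#|L| <= m.+1], so the subtraction is not
   truncated. *)
have -> : m.+1 = #|L| + (m.+1 - #|L|) by have := dR _ (dominable_self (A := R)); lia.
apply: shifted_collapsible_noncovers => //; apply: IH; first lia.
by move=> k /dR; lia.
Qed.

End Noncovers.

Theorem theorem1p3 (T : finType) (e : rel T) (n : nat)
    (e_sym : symmetric e) (e_irr : irreflexive e) (card_T : #|T| = n)
    (e_chordal : chordal e) (e_noiso : no_isolated e) :
  collapsible (n - indep_domination_number e - 1) (noncover_complex e).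
Proof.
have : shifted_collapsible (n - indep_domination_number e) (noncover_complex e).
  rewrite noncover_complexE; apply: shifted_collapsible_chordal => // k domk.
  rewrite cardsT card_T; suff : indep_domination_number e <= k by lia.
  rewrite /indep_domination_number; case: ex_minnP => g _; apply.
  apply/forallP=> I; apply/implyP=> iI; apply/existsP.
  by have [W [_ Wk domW]] := domk I (subsetT I) iI; exists W; rewrite Wk.
(* If the difference is 0, the complex is void and the truncated [0 - 1] is harmless. *)
case: (n - _) => [->|d]; first exact: collapsible_void.
by rewrite subn1.
Qed.
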